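(* Let $S$ be a semigroup, let $\mathcal{F}=\langle F_i\rangle_{i\in I}$ be a net in $\mathcal{P}_f(S)$, and let $A\subseteq S$. Suppose that at least one of the following two conditions holds: (1) there is some $b\in\mathbb{N}$ such that $S$ is $b$-weakly right cancellative; (2) there is some $b\in\mathbb{N}$ such that $S$ is $b$-weakly left cancellative, and $\mathcal{F}$ satisfies condition $( * )$. Consider the following statements. (a) $A$ is a $D$-set with respect to $\mathcal{F}$. (b) There is an $FP$-tree $\mathsf{T}$ in $A$ such that for each $F\in\mathcal{P}_f(\mathsf{T})$, $d_{\mathcal{F}}^*\big(\bigcap_{f\in F}B_f\big)>0$. (c) There is a $*$-tree $\mathsf{T}$ in $A$ such that for each $F\in\mathcal{P}_f(\mathsf{T})$, $d_{\mathcal{F}}^*\big(\bigcap_{f\in F}B_f\big)>0$. (d) There is a downward directed family $\langle C_F\rangle_{F\in J}$ of subsets of $A$ such that (i) for each $F\in J$ and each $s\in C_F$ there exists $G\in J$ with $C_G\subseteq s^{-1}C_F$, and (ii) for each $F\in J$, $d_{\mathcal{F}}^*(C_F)>0$. (e) There is a decreasing sequence $\langle C_n\rangle_{n\in\mathbb{N}}$ of subsets of $A$ such that (i) for each $n\in\mathbb{N}$ and each $s\in C_n$ there exists $m\in\mathbb{N}$ with $C_m\subseteq s^{-1}C_n$, and (ii) for each $n\in\mathbb{N}$, $d_{\mathcal{F}}^*(C_n)>0$. Then statements (a), (b), (c) and (d) are equivalent and are implied by statement (e). If $S$ is countable, then all five statements are equivalent.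
   Context: Semigroups are nonempty and discrete; $\mathbb{N}=\{1,2,\dots\}$; $\mathcal{P}_f(X)$ is the set of finite nonempty subsets of $X$. $\beta S$ is the space of ultrafilters on $S$ (Stone–Čech compactification), with basic open sets $\overline{A}=\{p\in\beta S: A\in p\}$ for $A\subseteq S$, and semigroup operation $pq=\{A\subseteq S:\{s\in S: s^{-1}A\in q\}\in p\}$, where $s^{-1}A=\{t\in S: st\in A\}$. For a net $\mathcal{F}=\langle F_i\rangle_{i\in I}$ in $\mathcal{P}_f(S)$ ($I$ a directed set) and $A\subseteq S$, the upper Banach density of $A$ with respect to $\mathcal{F}$ is $$d_{\mathcal{F}}^*(A)=\sup\{\alpha: (\forall i_0\in I)(\exists i\geq i_0)(\exists s\in S\cup\{1\})(|A\cap(F_i\cdot s)|\geq\alpha|F_i|)\},$$ where $F_i\cdot 1$ means $F_i$ ($S$ is not assumed to have an identity). Put $D_{\mathcal{F}}^*=\{p\in\beta S:(\forall A\in p)(d_{\mathcal{F}}^*(A)>0)\}$. A subset $A\subseteq S$ is a $D$-set with respect to $\mathcal{F}$ if $A\in p$ for some idempotent $p$ ($pp=p$) of $\beta S$ with $p\in D_{\mathcal{F}}^*$. $S$ is $b$-weakly left cancellative (respectively $b$-weakly right cancellative) if for all $t,u\in S$, $|\{s\in S: ts=u\}|\leq b$ (respectively $|\{s\in S: st=u\}|\leq b$). Condition $( * )$ for $\mathcal{F}$: $(\forall\epsilon>0)(\forall t\in S)(\exists c\in\mathbb{N})(\exists l\in I)(\forall i_0\geq l)(\exists i\geq i_0)(\exists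 s\in S\cup\{1\})\big(|(t\cdot F_{i_0})\setminus(F_i\cdot s)|<\epsilon\cdot|F_{i_0}|\text{ and }|F_i|\leq c\cdot|F_{i_0}|\big)$. Trees. Let $\omega=\{0,1,2,\dots\}$, where each $n\in\omega$ is identified with the set $\{0,\dots,n-1\}$ of its predecessors. $\mathsf{T}$ is a tree in $A$ if $\mathsf{T}$ is a nonempty set of functions such that for each $f\in\mathsf{T}$, $\mathrm{domain}(f)\in\omega$, $\mathrm{range}(f)\subseteq A$, and if $\mathrm{domain}(f)=n>0$ then $f|_{n-1}\in\mathsf{T}$. For a function $f$ with domain $n\in\omega$, $f^{\frown}s=f\cup\{(n,s)\}$. For a tree $\mathsf{T}$ and $f\in\mathsf{T}$, $B_f=B_f(\mathsf{T})=\{s: f^{\frown}s\in\mathsf{T}\}$. For $A\subseteq S$: $\mathsf{T}$ is a $*$-tree in $A$ if $\mathsf{T}$ is a tree in $A$ and for all $f\in\mathsf{T}$ and all $s\in B_f$, $B_{f^{\frown}s}\subseteq s^{-1}B_f$. $\mathsf{T}$ is an $FP$-tree in $A$ if $\mathsf{T}$ is a tree in $A$ and for all $f\in\mathsf{T}$, $B_f=\big\{\prod_{m\in F}g(m): g\in\mathsf{T},\ f\subsetneq g,\ \emptyset\neq F\subseteq\mathrm{dom}(g)\setminus\mathrm{dom}(f)\big\}$, products being taken in increasing order of indices. $\langle C_F\rangle_{F\in J}$ is a downward directed family if $J$ is a (nonempty) directed set and $F\leq G$ in $J$ implies $C_G\subseteq C_F$. *)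

(* Defs.v *)
From mathcomp Require Import all_boot all_order all_algebra.
From mathcomp Require Import finmap.
From mathcomp Require Import all_classical all_reals.

Set Implicit Arguments.
Unset Strict Implicit.
Unset Printing Implicit Defensive.

Import Order.TTheory GRing.Theory Num.Theory.

Local Open Scope classical_set_scope.
Local Open Scope ring_scope.

Definition directed_set (I : Type) (leI : I -> I -> Prop) : Prop :=
  [/\ inhabited I, RelationClasses.PreOrder leI &
      forall i j, exists k, leI i k /\ leI j k].

Section Semigroup.
Variable S : semigroupType.
Implicit Types (A : set S) (p q : set_system S).

Definition lquot (s : S) A : set S := [set t | A (s * t)%g].

Definition weakly_left_cancellative (b : nat) : Prop :=
  forall t u : S, ([set s | (t * s)%g = u] #<= `I_b)%card.

Definition weakly_right_cancellative (b : nat) : Prop :=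
  forall t u : S, ([set s | (s * t)%g = u] #<= `I_b)%card.

Definition beta : set (set_system S) := [set p | UltraFilter p].

Definition beta_mul p q : set_system S := [set A | p [set s | q (lquot s A)]].

Definition ltrans (t : S) (F : {fset S}) : {fset S} :=
  [fset (t * x)%g | x in F]%fset.

(* [None] plays the role of the element 1 adjoined to S. *)
Definition rtrans (F : {fset S}) (s : option S) : {fset S} :=
  if s is Some t then [fset (x * t)%g | x in F]%fset else F.

Section Density.
Variables (R : realType) (I : Type) (leI : I -> I -> Prop) (F : I -> {fset S}).

(* For nonempty directed [I] and nonempty [F i], the set below contains 0 and
   is bounded above by 1, so [sup] is a genuine supremum. *)
Definition upper_density A : R :=
  sup [set alpha : R | forall i0, exists i, leI i0 i /\
         exists s : option S,
           alpha * #|` F i|%:R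
             <= #|` [fset x in rtrans (F i) s | x \in A]%fset|%:R].

Definition Dstar : set (set_system S) :=
  [set p | beta p /\ forall A, p A -> 0 < upper_density A].

Definition Dset A : Prop :=
  exists p, [/\ beta p, beta_mul p p = p, Dstar p & p A].

Definition condition_star : Prop :=
  forall (eps : R) (t : S), 0 < eps ->
  exists (c : nat) (l : I), (0 < c)%N /\
  forall i0, leI l i0 -> exists i, leI i0 i /\
  exists s : option S,
    #|` (ltrans t (F i0) `\` rtrans (F i) s)%fset|%:R < eps * #|` F i0|%:R
    /\ (#|` F i| <= c * #|` F i0|)%N.

End Density.

(* A function f with domain n is encoded as the sequence
   [:: f 0; ...; f (n - 1)]: restriction to n - 1 is [take n.-1], f^frown s is
   [rcons f s], and inclusion of graphs is [prefix]. *)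
Section Trees.
Implicit Types (T : set (seq S)) (f g : seq S).

Definition is_tree T A : Prop :=
  T !=set0 /\
  forall f, T f ->
    (forall x, x \in f -> A x) /\
    ((0 < size f)%N -> T (take (size f).-1 f)).

Definition branch T f : set S := [set s | T (rcons f s)].

Definition is_star_tree T A : Prop :=
  is_tree T A /\
  forall f s, T f -> branch T f s ->
    branch T (rcons f s) `<=` lquot s (branch T f).

(* As S may lack an identity, the empty product is undefined. *)
Definition seq_prod (l : seq S) : option S :=
  if l is x :: l' then Some (foldl (fun y z => (y * z)%g) x l') else None.

(* [enum M] lists the indices in increasing order. *)
Definition sub_prod g (M : {set 'I_(size g)}) : option S :=
  seq_prod [seq tnth (in_tuple g) m | m <- enum M].

Definition FP_branch T f : set S :=
  [set x | exists (g : seq S) (M : {set 'I_(size g)}),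
     [/\ T g, prefix f g /\ f <> g, M != finset.set0,
         forall m, m \in M -> (size f <= m)%N &
         sub_prod M = Some x]].

Definition is_FP_tree T A : Prop :=
  is_tree T A /\ forall f, T f -> branch T f = FP_branch T f.

End Trees.

Section Statements.
Variables (R : realType) (I : Type) (leI : I -> I -> Prop) (F : I -> {fset S}).
Variable A : set S.
Local Notation dens := (upper_density R leI F).

Definition branches_dense (T : set (seq S)) : Prop :=
  forall H : {fset seq S}, H != fset0 -> [set` H] `<=` T ->
    0 < dens (\bigcap_(f in [set` H]) branch T f).

Definition has_dense_FP_tree : Prop :=
  exists T, is_FP_tree T A /\ branches_dense T.

Definition has_dense_star_tree : Prop :=
  exists T, is_star_tree T A /\ branches_dense T.

Definition has_dense_directed_family : Prop :=
  exists (J : Type) (leJ : J -> J -> Prop) (C : J -> set S),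
    [/\ directed_set leJ,
        forall j, C j `<=` A,
        forall j k, leJ j k -> C k `<=` C j,
        forall j s, C j s -> exists k, C k `<=` lquot s (C j) &
        forall j, 0 < dens (C j)].

Definition has_dense_sequence : Prop :=
  exists C : nat -> set S,
    [/\ forall n, C n `<=` A,
        forall n m, (n <= m)%N -> C m `<=` C n,
        forall n s, C n s -> exists m, C m `<=` lquot s (C n) &
        forall n, 0 < dens (C n)].

End Statements.
End Semigroup.

(* Main.v *)
(** A set of ultrafilters on [S] is closed iff it consists of the ultrafilters
    containing some filter, so compactness arguments in [beta S] are phrased
    with filters; in particular Ellis' theorem is a statement about the filters
    whose closed set is a subsemigroup.  Positivity of the density is partition
    regular, and the cancellation hypothesis (1) makes [Dstar] a right ideal,
    while (2) makes it closed under multiplication on the left by any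
    ultrafilter.  Given the family [C] of (d), the [p] in [Dstar] containing
    every [C j] therefore form a nonempty closed subsemigroup, whose idempotents
    witness (a).  Conversely, for an idempotent [p] containing [A], the
    sequences all of whose finite products lie in
    [A* = {x in A | x^-1 A in p}] form an FP-tree all of whose branch sets
    belong to [p].  FP-trees are star-trees, and finite intersections of branch
    sets of a star-tree form a directed family; when [S] is countable so is the
    tree, and intersections along an enumeration give the sequence of (e). *)
Require Import Defs.
From mathcomp Require Import all_boot all_order all_algebra.
From mathcomp Require Import finmap.
From mathcomp Require Import all_classical all_reals.
From mathcomp Require Import ring.

Set Implicit Arguments.
Unset Strict Implicit.
Unset Printing Implicit Defensive.

Import Order.TTheory GRing.Theory Num.Theory.

Local Open Scope classical_set_scope.
Local Open Scope ring_scope.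

(** * Filters and ultrafilters *)

Lemma ultra_setC {T : Type} (p : set_system T) (A : set T) :
  UltraFilter p -> p (~` A) <-> ~ p A.
Proof.
move=> up; split=> [pC pA|npA]; last by case: (in_ultra_setVsetC A up).
by apply: (filter_not_empty p); rewrite -(setICr A); exact: filterI.
Qed.

Lemma proper_ultra {T : Type} (p : set_system T) :
  ProperFilter p -> (forall A, p A \/ p (~` A)) -> UltraFilter p.
Proof.
move=> pp pV; split=> // G pG sub; apply/seteqP; split=> // A GA.
have [//|/sub GC] := pV A.
by case: (filter_not_empty G); rewrite -(setICr A); exact: filterI.
Qed.

Lemma filter_join_proper {T : Type} (G : set_system T) (X : set_system T) :
  ProperFilter G -> X setT -> setI_closed X ->
  (forall A B, G A -> X B -> A `&` B !=set0) ->
  ProperFilter [set B | exists A C, [/\ G A, X C & A `&` C `<=` B]].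
Proof.
move=> pG XT XI GX; apply: Build_ProperFilter_ex.
  by move=> B [A [C [GA XC sub]]]; have [x /sub] := GX _ _ GA XC; exists x.
split.
- by exists setT, setT; split=> //; exact: filterT.
- move=> B B' [A [C [GA XC sub]]] [A' [C' [GA' XC' sub']]].
  exists (A `&` A'), (C `&` C'); split; [exact: filterI|exact: XI|].
  by rewrite setIACA => x [/sub ? /sub' ?].
- move=> B B' BB' [A [C [GA XC sub]]]; exists A, C; split=> //.
  exact: subset_trans BB'.
Qed.

Lemma ultra_extend {T : Type} (G : set_system T) (X : set_system T) :
  ProperFilter G -> X setT -> setI_closed X ->
  (forall A B, G A -> X B -> A `&` B !=set0) ->
  exists p, [/\ UltraFilter p, G `<=` p & X `<=` p].
Proof.
move=> pG XT XI GX.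
have [p [up sub]] := ultraFilterLemma (filter_join_proper pG XT XI GX).
exists p; split=> // A XA; apply: sub.
  by exists A, setT; split=> // x [].
by exists setT, A; split=> //; exact: filterT.
Qed.

(** Otherwise the complement of [A] meets every member of [G], so some ultrafilter above [G]
    contains it. *)
Lemma mem_all_ultra {T : Type} (G : set_system T) (A : set T) :
  ProperFilter G -> (forall p, UltraFilter p -> G `<=` p -> p A) -> G A.
Proof.
move=> pG GA; apply: contrapT => nGA.
have [p [up Gp pA]] : exists p,
    [/\ UltraFilter p, G `<=` p & [set B | ~` A `<=` B] `<=` p].
  apply: ultra_extend => //.
  - by move=> B C nAB nAC x nAx; split; [exact: nAB|exact: nAC].
  - move=> B C GB nAC; apply: contrapT => disj; apply: nGA.
    apply: filterS GB => x Bx; apply: contrapT => nAx.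
    by apply: disj; exists x; split=> //; exact: nAC.
by have /ultra_setC := pA (~` A) (fun _ h => h); apply; exact: GA.
Qed.

(** * Products of ultrafilters and Ellis' theorem *)

Section BetaSemigroup.
Variable S : semigroupType.
Implicit Types (A : set S) (p q r G : set_system S).

Lemma lquotM (s t : S) A : lquot t (lquot s A) = lquot (s * t)%g A.
Proof. by apply/funext => u; rewrite /lquot /= mulgA. Qed.

Lemma beta_mulA p q r : beta_mul p (beta_mul q r) = beta_mul (beta_mul p q) r.
Proof.
apply/funext => A; congr p; apply/funext => s; congr q.
by apply/funext => t /=; rewrite lquotM.
Qed.

Lemma beta_mul_proper p q :
  ProperFilter p -> ProperFilter q -> ProperFilter (beta_mul p q).
Proof.
move=> pp pq; apply: Build_ProperFilter_ex.
  move=> A /(@filter_ex _ p)[s /(@filter_ex _ q)[t At]].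
  by exists (s * t)%g.
split.
- apply: (@filterS _ p _ setT); last exact: filterT.
  by move=> s _; exact: (@filterT _ q).
- move=> A B pA pB.
  apply: (@filterS _ p); last exact: (@filterI _ p _ _ _ pA pB).
  by move=> s [qA qB]; exact: (@filterI _ q).
- move=> A B AB; apply: (@filterS _ p) => s; apply: (@filterS _ q) => t.
  exact: AB.
Qed.

Lemma beta_mul_ultra p q :
  UltraFilter p -> UltraFilter q -> UltraFilter (beta_mul p q).
Proof.
move=> up uq; apply: proper_ultra => [|A]; first exact: beta_mul_proper.
have [pA|pC] := in_ultra_setVsetC [set s | q (lquot s A)] up; [by left|right].
by apply: filterS pC => s nqA; apply/ultra_setC.
Qed.

(** [A] is in [beta_mul q p] iff [pull p A] is in [q]: conditions on a product become conditions on
    its left factor. *)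
Let pull p A : set S := [set s | p (lquot s A)].

Let pull_imageT p r : ProperFilter p -> ProperFilter r -> (pull p @` r) setT.
Proof.
move=> pp pr; exists setT; first exact: filterT.
by apply/seteqP; split=> // s _; exact: filterT.
Qed.

Let pull_imageI p r : ProperFilter p -> ProperFilter r ->
  setI_closed (pull p @` r).
Proof.
move=> pp pr _ _ [A rA <-] [B rB <-]; exists (A `&` B); first exact: filterI.
apply/seteqP; split=> s; last by move=> [pA pB]; exact: filterI.
by move=> pAB; split; apply: filterS pAB => t [].
Qed.

(* [subsemigroup_filter G] says that the closed set of ultrafilters containing
   [G] is a nonempty subsemigroup of [beta]. *)
Definition subsemigroup_filter G :=
  ProperFilter G /\ forall p q, UltraFilter p -> UltraFilter q ->
    G `<=` p -> G `<=` q -> G `<=` beta_mul p q.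

Lemma maximal_subsemigroup_filter G : subsemigroup_filter G ->
  exists M, [/\ subsemigroup_filter M, G `<=` M &
    forall H, subsemigroup_filter H -> M `<=` H -> H = M].
Proof.
move=> sG.
(* [G] is adjoined because the union of the empty chain is empty, hence not a filter. *)
pose P := [set X : set_system S | subsemigroup_filter (G `|` X)].
have [Ch ChP Chtot|X [PX Xmax]] := @Zorn_bigcup _ P; last first.
  exists (G `|` X); split=> // H sH; rewrite subUset => -[GH XH].
  have HX : H `<=` X.
    apply: contrapT => nHX; apply: (Xmax H) => //.
    by rewrite /P /= setUidr.
  by apply/seteqP; split=> [A /HX|A [/GH|/XH]] //; right.
have [Ch0|/set0P[X0 ChX0]] := eqVneq Ch set0.
  by rewrite /P /= Ch0 bigcup_set0 setU0.
have mem X A : Ch X -> (G `|` X) A -> (G `|` \bigcup_(Y in Ch) Y) A.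
  by move=> ChX [GA|XA]; [left|right; exists X].
have mem2 A B :
    (G `|` \bigcup_(X in Ch) X) A -> (G `|` \bigcup_(X in Ch) X) B ->
    exists X, [/\ Ch X, (G `|` X) A & (G `|` X) B].
  move=> [GA|[X ChX XA]] [GB|[Y ChY YB]].
  - by exists X0; split=> //; left.
  - by exists Y; split=> //; [left|right].
  - by exists X; split=> //; [right|left].
  - have [XY|YX] := Chtot _ _ ChX ChY.
      by exists Y; split=> //; right=> //; exact: XY.
    by exists X; split=> //; right=> //; exact: YX.
split.
  apply: Build_ProperFilter_ex.
    move=> A UA; have [X [/ChP[pX _] XA _]] := mem2 _ _ UA UA.
    exact: (@filter_ex _ _ pX).
  split.
  - by left; have [pG _] := sG; exact: filterT.
  - move=> A B UA UB; have [X [ChX XA XB]] := mem2 _ _ UA UB.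
    by have [pX _] := ChP _ ChX; apply: mem ChX _; exact: filterI.
  - move=> A B AB UA; have [X [ChX XA _]] := mem2 _ _ UA UA.
    by have [pX _] := ChP _ ChX; apply: mem ChX _; exact: filterS XA.
move=> p q bp bq Up Uq A UA; have [X [ChX XA _]] := mem2 _ _ UA UA.
have [_ /(_ _ _ bp bq)] := ChP _ ChX; apply => // B XB.
- by apply: Up; exact: mem XB.
- by apply: Uq; exact: mem XB.
Qed.

(* Compactness: the ultrafilters containing [beta_mul G p] are exactly the
   products [q p] with [q] containing [G]. *)
Lemma ultra_above_mul G p r :
  ProperFilter G -> UltraFilter p -> UltraFilter r ->
  beta_mul G p `<=` r ->
  exists q, [/\ UltraFilter q, G `<=` q & beta_mul q p = r].
Proof.
move=> pG bp br sub.
have [q [bq Gq Xq]] : exists q,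
    [/\ UltraFilter q, G `<=` q & pull p @` r `<=` q].
  apply: ultra_extend => //; [exact: pull_imageT|exact: pull_imageI|].
  move=> B _ GB [A rA <-]; apply: contrapT => BA0.
  (* If [B] misses [pull p A], every [s] in [B] has the complement of [lquot s A] in [p]; so [r]
     contains the complement of [A]. *)
  suff /sub /ultra_setC : beta_mul G p (~` A) by exact.
  apply: (filterS _ GB) => s Bs; apply/ultra_setC => pA.
  by apply: BA0; exists s.
exists q; split=> //; apply: max_filter; first exact: beta_mul_proper.
by move=> A rA; apply: Xq; exists A.
Qed.

(* Ellis: with [M] maximal, its closed set [K] is a minimal closed
   subsemigroup; for [p] in [K], minimality gives [K p = K] and then
   [{q in K | q p = p} = K]. *)
Lemma idempotent_ultra G : subsemigroup_filter G ->
  exists p, [/\ UltraFilter p, beta_mul p p = p & G `<=` p].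
Proof.
move=> /maximal_subsemigroup_filter[M [[pM semiM] GM maxM]].
have [p [bp Mp]] := ultraFilterLemma pM.
have MpE : beta_mul M p = M.
  apply: maxM; first split; first exact: beta_mul_proper.
    move=> r1 r2 b1 b2 s1 s2.
    have [q1 [bq1 Mq1 <-]] := ultra_above_mul pM bp b1 s1.
    have [q2 [bq2 Mq2 <-]] := ultra_above_mul pM bp b2 s2.
    rewrite beta_mulA => A MA.
    suff : M `<=` beta_mul (beta_mul q1 p) q2 by exact.
    by apply: (semiM) => //; [exact: beta_mul_ultra|exact: semiM].
  (* Each [q] above [M] has [A] in [beta_mul q p], hence contains [pull p A]; therefore so does
     [M]. *)
  move=> A MA; apply: (@mem_all_ultra _ M (pull p A)) => // q bq Mq.
  by have /(_ A MA) := semiM _ _ bq bp Mq Mp.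
have [q [bq Mq qpE]] : exists q,
    [/\ UltraFilter q, M `<=` q & beta_mul q p = p].
  by apply: ultra_above_mul => //; rewrite MpE.
(* The ultrafilters above [L] are the [q] above [M] with [beta_mul q p = p]. *)
pose L := [set B | exists A C, [/\ M A, (pull p @` p) C & A `&` C `<=` B]].
have XT : (pull p @` p) setT by exact: pull_imageT.
have ML : M `<=` L by move=> A MA; exists A, setT; split=> // s [].
have LqE r : UltraFilter r -> L `<=` r -> beta_mul r p = p.
  move=> br Lr; apply: max_filter; first exact: beta_mul_proper.
  move=> A pA; apply: Lr; exists setT, (pull p A).
  by split; [exact: filterT|exists A|move=> s []].
have LE : L = M.
  apply: maxM => //; split.
    apply: filter_join_proper => //; first exact: pull_imageI.
    move=> A _ MA [B pB <-]; apply: (@filter_ex _ q).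
    by apply: filterI; [exact: Mq|move: pB; rewrite -{1}qpE].
  move=> q1 q2 b1 b2 L1 L2 B [A [_ [MA [C pC <-] sub]]].
  have bq12 := beta_mul_ultra b1 b2.
  apply: (filterS sub); apply: filterI.
    by apply: semiM MA => // D /ML; [exact: L1|exact: L2].
  suff : beta_mul (beta_mul q1 q2) p C by [].
  by rewrite -beta_mulA !LqE.
exists p; split=> //; last exact: subset_trans Mp.
by apply: LqE => //; rewrite LE.
Qed.

End BetaSemigroup.

(** * Counting in fibers and translates *)

Lemma leq_card_fibers {T U : choiceType} (f : T -> U) (b : nat) (X : {fset T}) :
  (forall u, ([set x | f x = u] #<= `I_b)%card) ->
  (#|` X| <= b * #|` [fset f x | x in X]%fset|)%N.
Proof.
move=> fibb; rewrite -sum1_size (partition_big_imfset _ f) /=.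
rewrite -[X in (_ <= _ * X)%N]sum1_size big_distrr /=.
apply: leq_sum => u _; rewrite muln1 sum1_count -size_filter.
have sub : ([set` [fset x in X | f x == u]%fset] #<= `I_b)%card.
  apply: card_le_trans (fibb u); apply: subset_card_le => x /=.
  by rewrite !inE => /andP[_ /eqP].
have := geq_card_fset_set sub; rewrite set_fsetK; apply: leq_trans.
apply: uniq_leq_size; first by rewrite filter_uniq.
by move=> x; rewrite mem_filter !inE andbC.
Qed.

Section Translates.
Variable S : semigroupType.
Implicit Types (X : {fset S}) (s u : option S).

(** [option S] is [S] with a unit adjoined, [ract] its right action on [S] and [rcomp] its product,
    so a translate of a translate is a translate. *)
Definition ract (x : S) s : S := if s is Some t then (x * t)%g else x.

Definition rcomp s u : option S := if s is Some t then Some (ract t u) else u.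

Lemma ract_comp x s u : ract (ract x s) u = ract x (rcomp s u).
Proof. by case: s u => [t|] [v|] //=; rewrite mulgA. Qed.

Lemma ract_mul t x s : ract (t * x)%g s = (t * ract x s)%g.
Proof. by case: s => [v|] //=; rewrite mulgA. Qed.

Lemma rtransP X s y :
  reflect (exists2 x, x \in X & y = ract x s) (y \in rtrans X s).
Proof.
case: s => [t|] /=.
  by apply: (iffP (imfsetP _ _ _ _)) => -[x xX ->]; exists x.
by apply: (iffP idP) => [yX|[x xX ->]] //; exists y.
Qed.

Lemma leq_card_rtrans X s : (#|` rtrans X s| <= #|` X|)%N.
Proof. by case: s => [t|] //=; exact: leq_imfset_card. Qed.

End Translates.

(** * Positive density and multiplication in [Dstar] *)

Section Density.
Variables (R : realType) (S : semigroupType) (I : Type) (leI : I -> I -> Prop).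
Variable F : I -> {fset S}.
Hypothesis dirI : directed_set leI.
Hypothesis F_neq0 : forall i, F i != fset0.
Local Notation dens := (upper_density R leI F).
Implicit Types A B : set S.

Lemma F_card_gt0 i : 0 < #|` F i|%:R :> R.
Proof. by rewrite ltr0n cardfs_gt0. Qed.

(** The supremum is over a set containing 0 and bounded by 1, as translation never enlarges a finite
    set. *)
Lemma upper_density_gt0P A : 0 < dens A <->
  exists2 alpha : R, 0 < alpha & forall i0, exists i, leI i0 i /\
    exists s, alpha * #|` F i|%:R <=
      #|` [fset x in rtrans (F i) s | x \in A]%fset|%:R.
Proof.
have [[i0] preI _] := dirI.
split=> [/sup_gt|[alpha alpha0 denA]].
  case=> [|alpha]; last by exists alpha.
  exists 0 => i; exists i; split.
    exact: RelationClasses.PreOrder_Reflexive.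
  by exists None; rewrite mul0r.
apply: lt_le_trans alpha0 _; apply: ub_le_sup => //.
exists 1 => x /(_ i0)[i [_ [s]]] => le_x.
rewrite -(ler_pM2r (F_card_gt0 i)) mul1r (le_trans le_x)// ler_nat.
apply: leq_trans (leq_card_rtrans (F i) s); apply: fsubset_leq_card.
by apply/fsubsetP => y; rewrite !inE => /andP[].
Qed.

Lemma upper_density_gt0S A B : A `<=` B -> 0 < dens A -> 0 < dens B.
Proof.
move=> AB /upper_density_gt0P[alpha alpha0 denA].
apply/upper_density_gt0P; exists alpha => // i0.
have [i [le_i [s le_s]]] := denA i0; exists i; split=> //; exists s.
rewrite (le_trans le_s)// ler_nat fsubset_leq_card//.
apply/fsubsetP => x; rewrite !inE => /andP[-> /=].
by rewrite !in_setE; exact: AB.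
Qed.

(** If both fail, [alpha / 2] is missed by each set on all translates beyond some index; at a common
    later index the two bounds contradict [alpha]. *)
Lemma upper_density_gt0U A B : 0 < dens (A `|` B) -> 0 < dens A \/ 0 < dens B.
Proof.
move=> /upper_density_gt0P[alpha alpha0 denAB].
have [_ preI dir] := dirI.
apply: contrapT => /not_orP[nA nB].
have small C : ~ 0 < dens C -> exists i0, forall i s, leI i0 i ->
    #|` [fset x in rtrans (F i) s | x \in C]%fset|%:R < alpha / 2 * #|` F i|%:R.
  move=> nC; apply: contrapT => nsmall; apply: nC.
  apply/upper_density_gt0P; exists (alpha / 2); first by rewrite divr_gt0.
  move=> i0; apply: contrapT => nlarge; apply: nsmall; exists i0 => i s le_i.
  rewrite ltNge; apply/negP => le_s; apply: nlarge.
  by exists i; split=> //; exists s.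
have [iA smallA] := small _ nA; have [iB smallB] := small _ nB.
have [k [Ak Bk]] := dir iA iB; have [i [le_i [s]]] := denAB k.
apply/negP; rewrite -ltNge.
have le_trI x y z : leI x y -> leI y z -> leI x z.
  exact: RelationClasses.PreOrder_Transitive.
have ltA := smallA i s (le_trI _ _ _ Ak le_i).
have ltB := smallB i s (le_trI _ _ _ Bk le_i).
rewrite [alpha]splitr mulrDl; apply: le_lt_trans (ltrD ltA ltB).
rewrite -natrD ler_nat.
have -> : [fset x in rtrans (F i) s | x \in (A `|` B)%classic]%fset =
    ([fset x in rtrans (F i) s | x \in A] `|`
     [fset x in rtrans (F i) s | x \in B])%fset.
  by apply/fsetP => x; rewrite !inE in_setU -andb_orr.
by rewrite cardfsU leq_subr.
Qed.

Lemma upper_density_set0 : ~ 0 < dens set0.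
Proof.
have [[i0] _ _] := dirI; move=> /upper_density_gt0P[alpha alpha0 /(_ i0)].
move=> [i [_ [s]]]; apply/negP; rewrite -ltNge.
have -> : [fset x in rtrans (F i) s | x \in (set0 : set S)]%fset = fset0.
  by apply/fsetP => x; rewrite !inE in_set0 andbF.
by rewrite cardfs0 mulr_gt0// F_card_gt0.
Qed.

(* Finitely many members [lquot h A] of [q] share a point [x], and right
   translation by [x] then carries a dense part of [F i s] into [A]. *)
Lemma Dstar_mulr b p q : (0 < b)%N -> weakly_right_cancellative S b ->
  Dstar R leI F p -> UltraFilter q -> Dstar R leI F (beta_mul p q).
Proof.
move=> b0 wrc [bp Dp] bq; split; first exact: beta_mul_ultra.
move=> A /Dp /upper_density_gt0P[alpha alpha0 denB].
(* Right multiplication by a point is at most [b]-to-one, which costs the factor [b]. *)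
apply/upper_density_gt0P; exists (alpha / b%:R).
  by rewrite divr_gt0 ?ltr0n.
move=> i0; have [i [le_i [s le_s]]] := denB i0; exists i; split=> //.
set B := [set s | _] in le_s.
pose H := [fset h in rtrans (F i) s | h \in B]%fset.
have qH : q (\bigcap_(h in [set` H]) lquot h A).
  apply: filter_bigI => h; rewrite !inE /= => /andP[_].
  by rewrite in_setE.
have [x Hx] := filter_ex qH.
exists (rcomp s (Some x)).
rewrite mulrAC ler_pdivrMr ?ltr0n// (le_trans le_s)// -natrM ler_nat mulnC.
apply: leq_trans (leq_card_fibers H (wrc x)) _.
rewrite leq_mul2l; apply/orP; right; apply: fsubset_leq_card.
apply/fsubsetP => _ /imfsetP[/= h hH ->]; rewrite !inE.
apply/andP; split; last by rewrite in_setE; exact: Hx.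
move: hH; rewrite !inE => /andP[/rtransP[y yF ->] _].
by apply/rtransP; exists y => //; rewrite -ract_comp.
Qed.

(** Left multiplication by [t] sends the part [H] of a translate of [F j] into [A], shrinking it at
    most [b]-fold; [condition_star] puts all but few image points into a translate of [F i], with
    [F i] at most [c] times as large as [F j]. *)
Lemma upper_density_lquot b t A : (0 < b)%N -> weakly_left_cancellative S b ->
  condition_star R leI F -> 0 < dens (lquot t A) -> 0 < dens A.
Proof.
move=> b0 wlc star /upper_density_gt0P[alpha alpha0 denA].
have [_ preI dir] := dirI.
have le_trI x y z : leI x y -> leI y z -> leI x z.
  exact: RelationClasses.PreOrder_Transitive.
have b0R : 0 < b%:R :> R by rewrite ltr0n.
(* The image of [H] then has at least [2 * eps] times the size of [F j], and less than half of this
   is lost in [D]. *)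
pose eps := alpha / (2 * b%:R).
have eps0 : 0 < eps by rewrite divr_gt0// mulr_gt0.
have [c [l [c0 starl]]] := star eps t eps0.
have c0R : 0 < c%:R :> R by rewrite ltr0n.
apply/upper_density_gt0P; exists (eps / c%:R); first by rewrite divr_gt0.
(* Being above [l] lets [condition_star] apply to [j]; being above [i0] is passed on to [i]. *)
move=> i0; have [k [lk i0k]] := dir l i0.
have [j [kj [s le_s]]] := denA k.
have [i [ji [u [ltu lec]]]] := starl _ (le_trI _ _ _ lk kj).
exists i; split; first exact: le_trI _ _ _ (le_trI _ _ _ i0k kj) ji.
exists (rcomp u s).
set K := [fset x in rtrans (F i) _ | _]%fset.
pose H := [fset h in rtrans (F j) s | h \in lquot t A]%fset.
pose D := (ltrans t (F j) `\` rtrans (F i) u)%fset.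
have sub : ([fset (t * h)%g | h in H] `<=` K `|` rtrans D s)%fset.
  apply/fsubsetP => _ /imfsetP[/= h hH ->].
  move: hH; rewrite !inE => /andP[/rtransP[y yF ->]].
  rewrite in_setE /lquot /= -ract_mul => Ay.
  have [tyi|tyi] := boolP ((t * y)%g \in rtrans (F i) u); apply/orP.
    left; apply/andP; split; last by rewrite in_setE.
    have /rtransP[z zF ->] := tyi.
    by apply/rtransP; exists z => //; rewrite ract_comp.
  right; apply/rtransP; exists (t * y)%g => //.
  by rewrite !inE tyi /=; apply/imfsetP; exists y.
have cardH : (#|` H| <= b * (#|` K| + #|` D|))%N.
  apply: leq_trans (leq_card_fibers H (wlc t)) _.
  rewrite leq_mul2l; apply/orP; right.
  apply: leq_trans (fsubset_leq_card sub) _.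
  apply: leq_trans (_ : #|` K| + #|` rtrans D s| <= _)%N.
    by rewrite cardfsU leq_subr.
  by rewrite leq_add2l leq_card_rtrans.
have cardHR : alpha * #|` F j|%:R <= b%:R * (#|` K|%:R + #|` D|%:R).
  by rewrite (le_trans le_s)// -natrD -natrM ler_nat.
have alphaE : alpha = b%:R * (eps + eps).
  by rewrite /eps invfM; field; rewrite gt_eqF.
have cardK : eps * #|` F j|%:R <= #|` K|%:R.
  move: cardHR; rewrite alphaE -mulrA ler_pM2l// mulrDl => le2.
  rewrite -(lerD2r (eps * #|` F j|%:R)) (le_trans le2)// lerD2l.
  exact: ltW.
apply: le_trans cardK; rewrite -mulrA ler_pM2l// mulrC ler_pdivrMr//.
by rewrite mulrC -natrM ler_nat.
Qed.

Lemma Dstar_mul p q :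
  ((exists b : nat, (0 < b)%N /\ weakly_right_cancellative S b)
       \/ ((exists b : nat, (0 < b)%N /\ weakly_left_cancellative S b)
           /\ condition_star R leI F)) ->
  Dstar R leI F p -> Dstar R leI F q -> Dstar R leI F (beta_mul p q).
Proof.
move=> [[b [b0 wrc]]|[[b [b0 wlc]] star]] Dp [bq Dq].
  exact: Dstar_mulr b0 wrc Dp bq.
have bp : UltraFilter p by case: Dp.
split; first exact: beta_mul_ultra.
(* [A] in the product forces some [lquot s A] into [q], hence to have positive density. *)
move=> A /(@filter_ex _ p)[s qA].
exact: upper_density_lquot b0 wlc star (Dq _ qA).
Qed.

Lemma directed_family_Dset A :
  (forall p q, Dstar R leI F p -> Dstar R leI F q ->
     Dstar R leI F (beta_mul p q)) ->
  has_dense_directed_family R leI F A -> Dset R leI F A.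
Proof.
move=> Dmul [J [leJ [C [[[j0] preJ dirJ] CA Cdecr Cshift Cdens]]]].
(* The ultrafilters above [G] are exactly the members of [Dstar] containing every [C j]; partition
   regularity makes [G] a filter. *)
pose G := [set B | exists j, ~ 0 < dens (C j `\` B)].
have GC j : G (C j) by exists j; rewrite setDv; exact: upper_density_set0.
have GD p : UltraFilter p -> G `<=` p -> Dstar R leI F p.
  move=> bp Gp; split=> // B pB; apply: contrapT => nB.
  have /Gp /ultra_setC : G (~` B); last by apply.
  by exists j0 => /(@upper_density_gt0S _ B); rewrite setDE setCK; auto.
have DG p : Dstar R leI F p -> (forall j, p (C j)) -> G `<=` p.
  move=> [bp Dp] pC B [j nj]; apply: contrapT => npB.
  have up : UltraFilter p by [].
  have pB : p (~` B) by apply/ultra_setC.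
  by apply: nj; apply: Dp; rewrite setDE; exact: filterI.
have pG : ProperFilter G.
  apply: Build_ProperFilter_ex.
    move=> B [j nj]; apply: contrapT => B0; apply: nj.
    suff -> : C j `\` B = C j by [].
    by apply/seteqP; split=> [x []//|x Cx]; split=> // Bx; apply: B0; exists x.
  split.
  - by exists j0; rewrite setDT; exact: upper_density_set0.
  - move=> B B' [j nj] [k nk]; have [l [jl kl]] := dirJ j k; exists l.
    move=> pos; have [] : 0 < dens (C j `\` B) \/ 0 < dens (C k `\` B').
    + apply: upper_density_gt0U; apply: upper_density_gt0S pos => x [Clx nBB'].
      have [Bx|nBx] := pselect (B x); [right|left]; split=> //.
      * exact: Cdecr kl _ Clx.
      * by move=> B'x; exact: nBB'.
      * exact: Cdecr jl _ Clx.
    + exact: nj.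
    + exact: nk.
  - move=> B B' BB' [j nj]; exists j => pos; apply: nj.
    by apply: upper_density_gt0S pos => x [Cx nB']; split=> // /BB'.
have sG : subsemigroup_filter G.
  split=> // p q bp bq Gp Gq; apply: DG; first by apply: Dmul; exact: GD.
  (* Each [s] in [C j] has some [C k], a member of [q], inside [lquot s (C j)]. *)
  move=> j; apply: (@filterS _ p _ (C j)); last exact: Gp.
  move=> s /Cshift[k sub]; apply: (@filterS _ q _ (C k)) => //; exact: Gq.
have [p [bp pp Gp]] := idempotent_ultra sG.
exists p; split=> //; first exact: GD.
by apply: (@filterS _ p _ (C j0)) => //; exact: Gp.
Qed.

End Density.

(** * Finite products and FP-trees *)

Section SeqProd.
Variable S : semigroupType.
Implicit Types (f g h t : seq S) (x y z : S).

Lemma seq_prod_cat h t x y : seq_prod h = Some x -> seq_prod t = Some y ->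
  seq_prod (h ++ t) = Some (x * y)%g.
Proof.
case: h t => [|a h] [|b t] //= [<-] [<-]; rewrite foldl_cat /=; congr Some.
elim/last_ind: t => [|t c IHt] //=.
by rewrite -!cats1 !foldl_cat /= IHt mulgA.
Qed.

Lemma sub_prod_mask g (M : {set 'I_(size g)}) :
  sub_prod M = seq_prod (mask [seq m \in M | m <- enum 'I_(size g)] g).
Proof.
rewrite /sub_prod; congr seq_prod.
rewrite -[X in mask _ X](map_tnth_enum (in_tuple g)) -map_mask -filter_mask.
by rewrite enumT.
Qed.

(** Index sets beyond [size f] are masks on the tail [t]; since the empty product is undefined,
    nonemptiness and [f <> g] become implicit. *)
Lemma FP_branchP (T : set (seq S)) f x : FP_branch T f x <->
  exists t h, [/\ T (f ++ t), subseq h t & seq_prod h = Some x].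
Proof.
split=> [[g [M [Tg [/prefixP[t gE] _] _ Mf prodM]]]|[t [h [Tt sub prodh]]]].
  subst g; exists t; move: prodM; rewrite sub_prod_mask.
  pose b k := oapp (mem M) false (insub k).
  have -> : [seq m \in M | m <- enum 'I_(size (f ++ t))] =
      nseq (size f) false ++ [seq b k | k <- iota (size f) (size t)].
    transitivity [seq b k | k <- iota 0 (size (f ++ t))].
      rewrite -val_enum_ord -map_comp; apply: eq_map => m.
      by rewrite /b /= valK.
    rewrite size_cat iotaD map_cat; congr cat.
    apply: (@eq_from_nth _ false); rewrite size_map size_iota ?size_nseq//.
    move=> k kf; rewrite (nth_map 0%N) ?size_iota// nth_iota// nth_nseq kf.
    rewrite /b; case: insubP => //= m _ mk.
    by apply/negbTE/negP => /Mf; rewrite mk leqNgt kf.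
  rewrite mask_cat ?size_nseq// mask_false cat0s => prodM.
  by eexists; split; [by []| |exact: prodM]; exact: mask_subseq.
have [m sm hE] := subseqP sub.
pose m' := nseq (size f) false ++ m.
have sm' : size m' = size (f ++ t) by rewrite !size_cat size_nseq sm.
pose M := finset.finset (fun i : 'I_(size (f ++ t)) => nth false m' i).
have prodM : sub_prod M = Some x.
  rewrite sub_prod_mask -prodh hE; congr seq_prod.
  have -> : [seq i \in M | i <- enum 'I_(size (f ++ t))] = m'.
    transitivity [seq nth false m' k | k <- iota 0 (size (f ++ t))].
      rewrite -val_enum_ord -map_comp; apply: eq_map => i.
      by rewrite /= finset.in_set.
    by rewrite map_nth_iota0 -?sm'// take_size.
  by rewrite mask_cat ?size_nseq// mask_false.
exists (f ++ t), M; split=> //.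
- split; first exact: prefix_prefix.
  move/(congr1 size)/eqP; rewrite size_cat -[X in X == _]addn0 eqn_add2l eq_sym.
  move=> /nilP t0; move: sub prodh; rewrite t0 subseq0 => /eqP ->.
  by [].
- by apply/eqP => M0; move: prodM; rewrite M0 /sub_prod enum_set0.
- move=> i; rewrite finset.in_set nth_cat size_nseq leqNgt; case: ltnP => // fi.
  by rewrite nth_nseq fi.
Qed.

(** Putting [s] in front of a product of entries beyond [rcons f s] gives a product of entries
    beyond [f]. *)
Lemma FP_tree_star_tree (T : set (seq S)) (A : set S) :
  is_FP_tree T A -> is_star_tree T A.
Proof.
move=> [treeT FPT]; split=> // f s Tf Tfs x.
rewrite FPT// => /FP_branchP[t [h [Tt sub prodh]]].
rewrite /lquot /= FPT//; apply/FP_branchP; exists (s :: t), (s :: h).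
rewrite -cat_rcons /= eqxx; split=> //.
exact: (@seq_prod_cat [:: s]).
Qed.

Lemma subseq_rconsP k f x : subseq k (rcons f x) ->
  subseq k f \/ exists2 k', k = rcons k' x & subseq k' f.
Proof.
case/subseqP => m; case/lastP: m => [|m b]; first by rewrite size_rcons.
rewrite !size_rcons => -[sm] ->; rewrite mask_rcons//.
case: b => /=; last by left; rewrite cats0 mask_subseq.
by right; exists (mask m f); rewrite ?cats1// mask_subseq.
Qed.

(** For an idempotent [p] containing [A], this set is in [p], and so is its quotient by each of its
    elements. *)
Definition star_set (p : set_system S) (A : set S) : set S :=
  A `&` [set s | p (lquot s A)].

Definition product_tree (B : set S) : set (seq S) :=
  [set f | forall h x, subseq h f -> seq_prod h = Some x -> B x].

Lemma product_tree_FP (B : set S) : is_FP_tree (product_tree B) B.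
Proof.
split.
  split; first by exists [::] => h x; rewrite subseq0 => /eqP ->.
  move=> f Tf; split=> [x xf|_ h x sub].
    by apply: (Tf [:: x]) => //; rewrite sub1seq.
  by apply: Tf; apply: subseq_trans sub _; exact: take_subseq.
move=> f Tf; apply/seteqP; split=> x.
  move=> Tfx; apply/FP_branchP; exists [:: x], [:: x]; split=> //.
  by rewrite cats1.
move=> /FP_branchP[t [h [Tt sub prodh]]] k y /subseq_rconsP[subk|[k' -> subk]].
  by apply: Tt; apply: subseq_trans subk _; exact: prefix_subseq.
(* As [x] is the product of [h], [rcons k' x] has the product of [k' ++ h], a subsequence of
   [f ++ t]. *)
have [->|] := eqVneq k' [::].
  move=> [<-]; apply: Tt prodh; apply: subseq_trans sub _.
  exact: suffix_subseq.
case k'E: (seq_prod k') => [z|]; last by case: (k') k'E.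
move=> _; rewrite -cats1 (seq_prod_cat k'E (erefl : seq_prod [:: x] = Some x)).
rewrite -(seq_prod_cat k'E prodh); apply: Tt.
exact: cat_subseq.
Qed.

(** It suffices that [s] lies in the star set and in its quotients by the finitely many products of
    subsequences of [f]; all of these are in [p]. *)
Lemma product_tree_branch (p : set_system S) (A : set S) f :
  UltraFilter p -> beta_mul p p = p -> p A -> product_tree (star_set p A) f ->
  p (branch (product_tree (star_set p A)) f).
Proof.
move=> up pp pA Tf.
have pstar : p (star_set p A).
  by apply: filterI => //; move: pA; rewrite -{1}pp.
have pshift z : star_set p A z -> p (lquot z (star_set p A)).
  move=> [_ pzA]; have : p (lquot z A `&` [set t | p (lquot t (lquot z A))]).
    by apply: filterI => //; move: pzA; rewrite -{1}pp.
  by apply: filterS => t [zt]; rewrite /= lquotM.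
have pall : p [set s | forall m : (size f).-tuple bool,
    forall z, seq_prod (mask m f) = Some z -> star_set p A (z * s)%g].
  apply: filter_forall => m.
  case mE: (seq_prod (mask m f)) => [z|]; last by apply: filterS filterT.
  have /pshift : star_set p A z by apply: Tf mE; exact: mask_subseq.
  by apply: filterS => s zs _ [<-].
apply: filterS (filterI pstar pall) => s [As alls] k y.
move=> /subseq_rconsP[subk|[k' -> /subseqP[m /eqP sm ->]]]; first exact: Tf.
have [->|] := eqVneq (mask m f) [::]; first by move=> [<-].
case mE: (seq_prod (mask m f)) => [z|]; last by case: (mask m f) mE.
move=> _; rewrite -cats1 (seq_prod_cat mE (erefl : seq_prod [:: s] = Some s)).
by move=> [<-]; exact: (alls (Tuple sm)).
Qed.

End SeqProd.

(** * From trees to directed families and sequences *)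

Section Trees.
Variables (R : realType) (S : semigroupType) (I : Type) (leI : I -> I -> Prop).
Variable F : I -> {fset S}.
Local Notation dens := (upper_density R leI F).
Implicit Types A B : set S.

Lemma Dset_FP_tree A : Dset R leI F A -> has_dense_FP_tree R leI F A.
Proof.
move=> [p [bp pp [_ Dp] pA]].
have up : UltraFilter p by [].
exists (product_tree (star_set p A)); split.
  have [[T0 treeT] FPT] := product_tree_FP (star_set p A).
  split=> //; split=> // f /treeT[fA ?]; split=> // x /fA.
  by case.
move=> H _ HT; apply: Dp; apply: filter_bigI => f fH.
by apply: product_tree_branch => //; exact: HT.
Qed.

Lemma FP_tree_dense_star A :
  has_dense_FP_tree R leI F A -> has_dense_star_tree R leI F A.
Proof.
by move=> [T [FPT dT]]; exists T; split=> //; exact: FP_tree_star_tree.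
Qed.

(** Indices are finite nonempty sets of nodes; for [s] in [C H], appending [s] to every node of [H]
    gives the required index. *)
Lemma star_tree_directed_family A :
  has_dense_star_tree R leI F A -> has_dense_directed_family R leI F A.
Proof.
move=> [T [[[[f0 Tf0] treeT] starT] dT]].
pose J := {H : {fset seq S} | H != fset0 /\ [set` H] `<=` T}.
pose mkJ H (H_ok : H != fset0 /\ [set` H] `<=` T) : J := exist _ H H_ok.
pose C (H : J) := \bigcap_(f in [set` projT1 H]) branch T f.
exists J, (fun H K : J => projT1 H `<=` projT1 K)%fset, C; split.
- split.
  + have H0 : [fset f0]%fset != fset0 /\ [set` [fset f0]%fset] `<=` T.
      split; first by apply/fset0Pn; exists f0; rewrite inE.
      by move=> f /=; rewrite inE => /eqP ->.
    exact: (inhabits (mkJ _ H0)).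
  + by split=> [H|H K L]; [exact: fsubset_refl|exact: fsubset_trans].
  + move=> [H [H0 HT]] [K [K0 KT]].
    have HK : (H `|` K)%fset != fset0 /\ [set` (H `|` K)%fset] `<=` T.
      split; last by move=> f /=; rewrite inE => /orP[/HT|/KT].
      by apply: contraNneq H0; move=> /eqP; rewrite fsetU_eq0 => /andP[].
    by exists (mkJ _ HK) => /=; rewrite fsubsetUl fsubsetUr.
- move=> [H [H0 HT]] s Cs; have [f fH] := fset0Pn _ H0.
  have [memA _] := treeT _ (Cs _ fH).
  by apply: memA; rewrite mem_rcons mem_head.
- by move=> H K /fsubsetP HK s Ks f /HK; exact: Ks.
- move=> [H [H0 HT]] s Cs.
  have H' : [fset rcons f s | f in H]%fset != fset0 /\
      [set` [fset rcons f s | f in H]%fset] `<=` T.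
    split; last by move=> _ /imfsetP[f /= fH ->]; exact: Cs.
    have [f fH] := fset0Pn _ H0; apply/fset0Pn; exists (rcons f s).
    by apply/imfsetP; exists f.
  exists (mkJ _ H') => x Cx f fH.
  apply: starT; [exact: (HT _ fH)|exact: (Cs _ fH)|].
  by apply: Cx; apply/imfsetP; exists f.
- by move=> [H [H0 HT]]; exact: dT.
Qed.

Lemma countable_seq : countable [set: S] -> countable [set: seq S].
Proof.
move=> /countable_injP[f finj]; apply/countable_injP.
exists (fun s => choice.pickle (map f s)) => s t _ _ /(pcan_inj choice.pickleK).
by apply: inj_map => x y; apply: finj; rewrite in_setE.
Qed.

Lemma star_tree_sequence A : countable [set: S] ->
  has_dense_star_tree R leI F A -> has_dense_sequence R leI F A.
Proof.
move=> /countable_seq cS [T [[[[f0 Tf0] treeT] starT] dT]].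
have cT : countable T by apply: sub_countable cS; exact: subset_card_le.
have [T0|[g]] := pfcard_geP cT; first by move: Tf0; rewrite T0.
have gT n : T (g n) by exact: funS.
have gsurj f : T f -> exists n, g n = f.
  by move=> Tf; have [n _ <-] := @surj _ _ _ _ g f Tf; exists n.
(* With [n.+1] at least one branch set is always intersected, so even [C 0] lies in [A]. *)
pose C n := \bigcap_(i in `I_n.+1) branch T (g i).
exists C; split.
- move=> n s Cs; have [memA _] := treeT _ (Cs 0%N isT).
  by apply: memA; rewrite mem_rcons mem_head.
- by move=> n m nm s Cs i /= ni; apply: Cs; exact: (leq_ltn_trans (n := n)).
- move=> n s Cs; have [m gm] : exists m, forall i, (i < n.+1)%N ->
      exists2 j, (j < m.+1)%N & g j = rcons (g i) s.
    have /choice[e ge] :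
        forall i, exists j, (i < n.+1)%N -> g j = rcons (g i) s.
      move=> i; have [lt_in|] := boolP (i < n.+1)%N; last by exists 0%N.
      by have [j gj] := gsurj _ (Cs i lt_in); exists j.
    (* [e i] is a position of [rcons (g i) s] in the enumeration; the maximum covers all [i] at
       once. *)
    exists (\max_(i < n.+1) e i) => i lt_in; exists (e i); last exact: ge.
    exact: (leq_bigmax (Ordinal lt_in)).
  exists m => x Cx i /= lt_in; have [j lt_jm gj] := gm i lt_in.
  by apply: starT; [exact: gT|exact: Cs|rewrite -gj; exact: Cx].
- move=> n; pose H := seq_fset tt [seq g i | i <- iota 0 n.+1].
  have HP f : f \in H -> exists2 i, (i < n.+1)%N & f = g i.
    by rewrite seq_fsetE => /mapP[i]; rewrite mem_iota => lt_in ->; exists i.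
  have gH i : (i < n.+1)%N -> g i \in H.
    by move=> lt_in; rewrite seq_fsetE map_f// mem_iota.
  have -> : C n = \bigcap_(f in [set` H]) branch T f.
    apply/seteqP; split=> [s Cs _ /HP[i lt_in ->]|s Hs i lt_in].
      exact: Cs.
    exact/Hs/gH.
  apply: dT; last by move=> _ /HP[i _ ->].
  by apply/fset0Pn; exists (g 0%N); exact: gH.
Qed.

Lemma sequence_directed_family A :
  has_dense_sequence R leI F A -> has_dense_directed_family R leI F A.
Proof.
move=> [C [CA Cdecr Cshift Cdens]].
exists nat, (fun n m => (n <= m)%N), C; split=> //.
split; first exact: (inhabits 0%N).
  by split=> [n|n m k] //; exact: leq_trans.
by move=> n m; exists (maxn n m); rewrite leq_maxl leq_maxr.
Qed.

End Trees.

Theorem theorem4p5 (R : realType) (S : semigroupType)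
  (I : Type) (leI : I -> I -> Prop) (F : I -> {fset S}) (A : set S)
  (dirI : directed_set leI)
  (F_neq0 : forall i, F i != fset0)
  (cond : (exists b : nat, (0 < b)%N /\ weakly_right_cancellative S b)
       \/ ((exists b : nat, (0 < b)%N /\ weakly_left_cancellative S b)
           /\ condition_star R leI F)) :
  [/\ [<-> Dset R leI F A;
           has_dense_FP_tree R leI F A;
           has_dense_star_tree R leI F A;
           has_dense_directed_family R leI F A],
      has_dense_sequence R leI F A -> Dset R leI F A &
      countable [set: S] ->
      [<-> Dset R leI F A;
           has_dense_FP_tree R leI F A;
           has_dense_star_tree R leI F A;
           has_dense_directed_family R leI F A;
           has_dense_sequence R leI F A]].
Proof.
have ab := @Dset_FP_tree R S I leI F A.
have bc := @FP_tree_dense_star R S I leI F A.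
have cd := @star_tree_directed_family R S I leI F A.
have Dmul p q := @Dstar_mul R S I leI F dirI F_neq0 p q cond.
have da := directed_family_Dset dirI F_neq0 Dmul (A := A).
have ed := @sequence_directed_family R S I leI F A.
split=> [||cS]; [by tfae|by move=> /ed|].
have ce := @star_tree_sequence R S I leI F A cS.
(* From (d) to (e) the route is through (a), (b) and (c), since the sequence is extracted from a
   star-tree. *)
by tfae => // [/da/ab/bc/ce|/ed/da].
Qed.
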